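(* Let $\alpha(s)$ and $\beta(t)$ be arc length curves in $\mathbb{S}^3$ such that $\langle\overline{\alpha}\cdot t_\alpha,\ \beta\cdot\overline{t_\beta}\rangle=C$. Then $\kappa_\alpha\equiv0$ and either $\kappa_\beta\equiv0$ or $\beta$ is a general helix with $\tau_\beta=\frac{C}{\eta}\kappa_\beta-1$, $C,\eta\in\mathbb{R}$.
   Context: $\mathbb{R}^4$ is identified with the quaternions, ''$\cdot$'' is quaternion multiplication, $\overline{x}$ is conjugation, $\langle\cdot,\cdot\rangle$ is the Euclidean inner product, and $\mathbb{S}^3$ is the set of unit quaternions with the induced metric and Levi-Civita connection $\nabla$. For an arc length curve $\gamma$ in $\mathbb{S}^3$: $t_\gamma=\gamma'$, $\kappa_\gamma=|\nabla_{\gamma'}\gamma'|$; where $\kappa_\gamma\neq0$, $n_\gamma=\kappa_\gamma^{-1}\nabla_{\gamma'}\gamma'$, $b_\gamma\in T_\gamma\mathbb{S}^3$ is the unit vector orthogonal to $t_\gamma,n_\gamma$ with $\det(\gamma,t_\gamma,n_\gamma,b_\gamma)>0$, and the torsion $\tau_\gamma$ is defined by $\nabla_{t_\gamma}n_\gamma=-\kappa_\gamma t_\gamma+\tau_\gamma b_\gamma$. The hypothesis means that the inner product takes the same constant value $C$ for all $s,t$. A curve $\gamma$ in $\mathbb{S}^3$ is a general helix if there is a Killing vector field $V$ of constant length along $\gamma$ such that the angle between $V$ and $\gamma'$ is a nonzero constant along $\gamma$. Equivalently (known theorem of Barros), either $\tau_\gamma\equiv0$ and $\gamma$ lies in some unit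 2-sphere, or $\tau_\gamma=b\kappa_\gamma\pm1$ for some constant $b$.
   Formalization: κ_α≡0 can fail (small circle α, great circle β), so the mirror case is added: κ_β≡0 and α is a general helix with τ_α=(C/η)κ_α+1. The torsion relation is claimed on intervals where the curvature has no zero, with η up to sign on each, since one η can fail across zeros. *)

(* Defs.v *)
From HB Require Import structures.
From mathcomp Require Import all_boot all_order all_algebra.
From mathcomp Require Import all_classical all_reals all_analysis.

Set Implicit Arguments.
Unset Strict Implicit.
Unset Printing Implicit Defensive.

Import Order.TTheory GRing.Theory Num.Theory numFieldNormedType.Exports.
Local Open Scope ring_scope.
Local Open Scope classical_set_scope.

Section Quaternions.
Context {R : realType}.
Implicit Types p q u v : 'rV[R]_4.

(* The row (a, b, c, d) is the quaternion a + b i + c j + d k. *)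
Definition quat (a b c d : R) : 'rV[R]_4 := \row_(i < 4) [:: a; b; c; d]`_i.

Definition qre p : R := p 0 (inord 0).
Definition qi p : R := p 0 (inord 1).
Definition qj p : R := p 0 (inord 2).
Definition qk p : R := p 0 (inord 3).

Definition qmul p q : 'rV[R]_4 :=
  quat (qre p * qre q - qi p * qi q - qj p * qj q - qk p * qk q)
       (qre p * qi q + qi p * qre q + qj p * qk q - qk p * qj q)
       (qre p * qj q - qi p * qk q + qj p * qre q + qk p * qi q)
       (qre p * qk q + qi p * qj q - qj p * qi q + qk p * qre q).

Definition qconj p : 'rV[R]_4 := quat (qre p) (- qi p) (- qj p) (- qk p).

(* The library norm `|p| on row vectors is the sup norm, hence enorm. *)
Definition inner u v : R := \sum_(i < 4) u 0 i * v 0 i.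
Definition enorm u : R := Num.sqrt (inner u u).

Definition angle u v : R := acos (inner u v / (enorm u * enorm v)).

Definition det4 u1 u2 u3 u4 : R :=
  \det (\matrix_(i < 4) [:: u1; u2; u3; u4]`_i).

End Quaternions.

Section SphereCurves.
Context {R : realType}.
Implicit Types (I : set R) (g W : R -> 'rV[R]_4) (p u v : 'rV[R]_4)
  (V : 'rV[R]_4 -> 'rV[R]_4).

Definition sphere3 : set 'rV[R]_4 := [set p | enorm p = 1].

Definition tangent_at p v : Prop := inner p v = 0.

Definition tproj p v : 'rV[R]_4 := v - inner v p *: p.

(* The Levi-Civita connection of the induced metric is the tangential
   projection of the flat derivative of R^4: [covd] differentiates a vector
   field W along a curve g, [nabla] a vector field V (given through an extension
   to R^4) in a tangent direction v at p. *)
Definition covd g W (s : R) : 'rV[R]_4 := tproj (g s) (derive1 W s).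
Definition nabla v V p : 'rV[R]_4 := tproj p ('D_v V p).

(* A smooth unit-speed curve on a nonempty open, possibly unbounded, interval. *)
Definition arclength_curve I g : Prop :=
  [/\ [/\ open I, is_interval I & I !=set0],
      forall (n : nat) s, I s -> derivable (derive1n n g) s 1,
      forall s, I s -> sphere3 (g s)
    & forall s, I s -> enorm (derive1 g s) = 1].

Definition tangent g : R -> 'rV[R]_4 := derive1 g.

Definition curvature g (s : R) : R := enorm (covd g (tangent g) s).

(* [normal], [binormal] and [torsion] are meaningful only at parameters where
   the curvature does not vanish. *)
Definition normal g (s : R) : 'rV[R]_4 :=
  (curvature g s)^-1 *: covd g (tangent g) s.

Definition is_binormal g (s : R) v : Prop :=
  [/\ tangent_at (g s) v, enorm v = 1,
      inner v (tangent g s) = 0, inner v (normal g s) = 0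
    & 0 < det4 (g s) (tangent g s) (normal g s) v].

Definition binormal g (s : R) : 'rV[R]_4 :=
  xget 0 [set v | is_binormal g s v].

Definition torsion g (s : R) : R :=
  xget 0 [set tau | covd g (normal g) s =
    - curvature g s *: tangent g s + tau *: binormal g s].

(* All iterated directional derivatives are (Frechet) differentiable. *)
Definition smooth_field V : Prop :=
  forall (vs : seq 'rV[R]_4) p,
    differentiable (foldr (fun v F => 'D_v F) V vs) p.

(* A smooth vector field on the sphere is represented by a smooth extension to
   R^4; only its values on the sphere matter. *)
Definition killing_field V : Prop :=
  [/\ smooth_field V,
      forall p, sphere3 p -> tangent_at p (V p)
    & forall p u v, sphere3 p -> tangent_at p u -> tangent_at p v ->
        inner (nabla u V p) v + inner u (nabla v V p) = 0].

(* The constant length l is required to be nonzero so that the angle between V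
   and the curve makes sense. *)
Definition general_helix I g : Prop :=
  exists V, killing_field V /\
    exists l theta : R, [/\ 0 < l, theta != 0
      & forall s, I s -> enorm (V (g s)) = l /\
                         angle (V (g s)) (tangent g s) = theta].

(* The relation tau = (C / eta) kappa + e. When kappa has no zero on I, taking
   K = I gives it on all of I with a single constant (eta or - eta). At a zero
   of kappa the torsion is undefined and the frame vectors n, b may change sign
   (as for a plane curve at an inflection point), which changes the sign of
   eta; so on each interval K without zeros of kappa the constant is eta or
   - eta. The offset e is - 1 for the curve beta and + 1 for alpha, because the
   two roles are exchanged by quaternion conjugation, which reverses the
   orientation and so changes the sign of the torsion. *)
Definition torsion_relation I g (C e : R) : Prop :=
  exists eta : R, eta != 0 /\
    forall K : set R, is_interval K -> K `<=` I ->
      (forall s, K s -> curvature g s != 0) ->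
      (forall s, K s -> torsion g s = C / eta * curvature g s + e) \/
      (forall s, K s -> torsion g s = C / (- eta) * curvature g s + e).

End SphereCurves.

(* Main.v *)
(* The unit imaginary curves a = conj(alpha) alpha' and b = beta conj(beta')
   have speeds kappa_alpha and kappa_beta, and <a, b> = C gives
   <a', b> = <a, b'> = <a', b'> = 0.  If a' and b' are nonzero at some
   parameters, then there a and b are both orthogonal to the orthogonal
   imaginary vectors a' and b', hence parallel, so C^2 = 1; but C^2 = 1 forces
   a = C b for all parameters, so both curves are geodesics.
   When C^2 <> 1, fix one value of a: left multiplication F by its conjugate is
   a skew isometry of R^4, so a Killing field of unit length, and
   <F beta, beta'> = C.  Differentiating once gives <F beta, n> = 0, hence
   F beta = C t + h b with h^2 = 1 - C^2 (b now the binormal); differentiating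
   again gives h - C kappa + h tau = 0.  Right multiplication by a value of
   beta conj(beta'), applied to alpha, has the opposite orientation, which
   flips the sign of the first h. *)

Require Import Defs.
From HB Require Import structures.
From mathcomp Require Import all_boot all_order all_algebra.
From mathcomp Require Import all_classical all_reals all_analysis.
From mathcomp Require Import ring lra.

Import Order.TTheory GRing.Theory Num.Theory numFieldNormedType.Exports.
Local Open Scope ring_scope.
Local Open Scope classical_set_scope.

Set Implicit Arguments.
Unset Strict Implicit.
Unset Printing Implicit Defensive.

(** * Determinants by repeated expansion along the first row *)

Definition natdet (R : comNzRingType) n (f : nat -> nat -> R) : R :=
  \det (\matrix_(i < n, j < n) f i j).

(** With entries indexed by natural numbers, each minor is again a [natdet], [bump j] skipping
    column j, so the expansion iterates by rewriting. *)
Lemma natdet_expand (R : comNzRingType) n (f : nat -> nat -> R) :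
  natdet n.+1 f = \sum_(0 <= j < n.+1)
    (-1) ^+ j * f 0%N j * natdet n (fun i k => f i.+1 (bump j k)).
Proof.
rewrite /natdet (expand_det_row _ ord0) big_mkord; apply: eq_bigr => j _.
rewrite mxE /cofactor mulrCA mulrA; congr (_ * \det _).
by apply/matrixP => i k; rewrite !mxE.
Qed.

Lemma natdet3 (R : comNzRingType) (f : nat -> nat -> R) :
  natdet 3 f =
  f 0 0 * (f 1 1 * f 2 2 - f 1 2 * f 2 1)
  - f 0 1 * (f 1 0 * f 2 2 - f 1 2 * f 2 0)
  + f 0 2 * (f 1 0 * f 2 1 - f 1 1 * f 2 0).
Proof.
do 3 (rewrite !natdet_expand !big_nat_recr //= !big_geq // !add0r).
rewrite /natdet !det_mx00 /bump /=; ring.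
Qed.

(** * Euclidean inner product, quaternion multiplication and the triple product *)

Section InnerProduct.
Context {R : realType}.
Implicit Types (u v w p q g t n : 'rV[R]_4) (a : R).

Lemma innerC u v : inner u v = inner v u.
Proof. by apply: eq_bigr => i _; rewrite mulrC. Qed.

Lemma innerDl u v w : inner (u + v) w = inner u w + inner v w.
Proof.
by rewrite /inner -big_split; apply: eq_bigr => i _; rewrite mxE mulrDl.
Qed.

Lemma innerZl a u w : inner (a *: u) w = a * inner u w.
Proof. by rewrite /inner mulr_sumr; apply: eq_bigr => i _; rewrite mxE mulrA. Qed.

Lemma innerNl u w : inner (- u) w = - inner u w.
Proof. by rewrite -scaleN1r innerZl mulN1r. Qed.

Lemma innerBl u v w : inner (u - v) w = inner u w - inner v w.
Proof. by rewrite innerDl innerNl. Qed.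

Lemma innerDr u v w : inner w (u + v) = inner w u + inner w v.
Proof. by rewrite !(innerC w) innerDl. Qed.

Lemma innerZr a u w : inner w (a *: u) = a * inner w u.
Proof. by rewrite !(innerC w) innerZl. Qed.

Lemma innerBr u v w : inner w (u - v) = inner w u - inner w v.
Proof. by rewrite !(innerC w) innerBl. Qed.

Lemma inner_ge0 u : 0 <= inner u u.
Proof. by apply: sumr_ge0 => i _; rewrite -expr2 sqr_ge0. Qed.

Lemma inner_eq0 u : (inner u u == 0) = (u == 0).
Proof.
apply/idP/eqP => [|->]; last by rewrite -(scale0r 0) innerZl mul0r.
rewrite psumr_eq0 => [/allP u0|i _]; last by rewrite -expr2 sqr_ge0.
apply/rowP => i; rewrite mxE; apply/eqP.
by rewrite -sqrf_eq0 expr2; apply: u0; rewrite mem_index_enum.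
Qed.

Lemma inner_gt0 u : u != 0 -> 0 < inner u u.
Proof. by rewrite -inner_eq0 lt_def inner_ge0 andbT. Qed.

Lemma enorm_sqr u : enorm u ^+ 2 = inner u u.
Proof. by rewrite sqr_sqrtr ?inner_ge0. Qed.

Lemma enorm_eq0 u : (enorm u == 0) = (u == 0).
Proof. by rewrite -sqrf_eq0 enorm_sqr inner_eq0. Qed.

Lemma enorm1P u : enorm u = 1 <-> inner u u = 1.
Proof.
by split=> [u1|u1]; [rewrite -enorm_sqr u1 expr1n|rewrite /enorm u1 sqrtr1].
Qed.

Lemma sum_ord4 (F : 'I_4 -> R) : \sum_(i < 4) F i =
  F (inord 0) + F (inord 1) + F (inord 2) + F (inord 3).
Proof.
rewrite !big_ord_recl big_ord0 addr0 !addrA.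
by do ![congr (_ + _)]; congr F; apply: val_inj; rewrite /= inordK.
Qed.

Lemma innerE u v :
  inner u v = qre u * qre v + qi u * qi v + qj u * qj v + qk u * qk v.
Proof. by rewrite /inner sum_ord4. Qed.

Lemma qreE a b c d : qre (quat a b c d : 'rV[R]_4) = a.
Proof. by rewrite /qre mxE inordK. Qed.
Lemma qiE a b c d : qi (quat a b c d : 'rV[R]_4) = b.
Proof. by rewrite /qi mxE inordK. Qed.
Lemma qjE a b c d : qj (quat a b c d : 'rV[R]_4) = c.
Proof. by rewrite /qj mxE inordK. Qed.
Lemma qkE a b c d : qk (quat a b c d : 'rV[R]_4) = d.
Proof. by rewrite /qk mxE inordK. Qed.

Definition quatE := (qreE, qiE, qjE, qkE).

Lemma coord_nth p i : p 0 i = [:: qre p; qi p; qj p; qk p]`_i.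
Proof.
by case: i => -[|[|[|[|//]]]] lt4 /=; congr (p 0 _); apply: val_inj;
  rewrite /= inordK.
Qed.

Lemma quat_ext p q :
  qre p = qre q -> qi p = qi q -> qj p = qj q -> qk p = qk q -> p = q.
Proof.
by move=> e0 e1 e2 e3; apply/rowP => i; rewrite !coord_nth e0 e1 e2 e3.
Qed.

Lemma coordDZ a p q : [/\ qre (a *: p + q) = a * qre p + qre q,
  qi (a *: p + q) = a * qi p + qi q, qj (a *: p + q) = a * qj p + qj q
  & qk (a *: p + q) = a * qk p + qk q].
Proof. by rewrite /qre /qi /qj /qk !mxE. Qed.

Lemma qmul_linear p : linear (qmul p).
Proof.
move=> a u v; rewrite {1}/qmul; have [-> -> -> ->] := coordDZ a u v.
by apply: quat_ext; have [e0 e1 e2 e3] := coordDZ a (qmul p u) (qmul p v);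
  rewrite ?(e0, e1, e2, e3) !quatE; ring.
Qed.

HB.instance Definition _ p :=
  GRing.isLinear.Build R 'rV[R]_4 'rV[R]_4 _ (qmul p) (qmul_linear p).

(* Arguments are swapped so that [qmulr q] is the linear map p |-> p q. *)
Definition qmulr q p := qmul p q.

Lemma qmulr_linear q : linear (qmulr q).
Proof.
move=> a u v; rewrite /qmulr {1}/qmul; have [-> -> -> ->] := coordDZ a u v.
by apply: quat_ext; have [e0 e1 e2 e3] := coordDZ a (qmul u q) (qmul v q);
  rewrite ?(e0, e1, e2, e3) !quatE; ring.
Qed.

HB.instance Definition _ q :=
  GRing.isLinear.Build R 'rV[R]_4 'rV[R]_4 _ (qmulr q) (qmulr_linear q).

Lemma inner_qmul p u v : inner (qmul p u) (qmul p v) = inner p p * inner u v.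
Proof. by rewrite !innerE !quatE; ring. Qed.

Lemma inner_qmulr p u v : inner (qmul u p) (qmul v p) = inner p p * inner u v.
Proof. by rewrite !innerE !quatE; ring. Qed.

Lemma inner_qconj u v : inner (qconj u) (qconj v) = inner u v.
Proof. by rewrite !innerE !quatE; ring. Qed.

Lemma qre_conj_mul u v : qre (qmul (qconj u) v) = inner u v.
Proof. by rewrite innerE !quatE; ring. Qed.

Lemma qre_mul_conj u v : qre (qmul u (qconj v)) = inner u v.
Proof. by rewrite innerE !quatE; ring. Qed.

(** The adjoint of left multiplication by conj(u) is left multiplication by u. The pairing with a
    fixed q thus becomes <F u, v> for the linear field F of right multiplication by q. *)
Lemma inner_conj_mul u v q :
  inner (qmul (qconj u) v) q = inner (qmulr q u) v.
Proof. by rewrite !innerE !quatE; ring. Qed.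

(** The mirror image: here the linear field is left multiplication by conj(q). *)
Lemma inner_mul_conj u v q :
  inner q (qmul u (qconj v)) = inner (qmul (qconj q) u) v.
Proof. by rewrite !innerE !quatE; ring. Qed.

(** The adjoint of multiplication by p is multiplication by conj(p), which is - p for imaginary
    p. *)
Lemma qmul_skew p u v :
  qre p = 0 -> inner (qmul p u) v = - inner u (qmul p v).
Proof. by move=> p0; rewrite !innerE !quatE p0; ring. Qed.

Lemma qmulr_skew p u v :
  qre p = 0 -> inner (qmulr p u) v = - inner u (qmulr p v).
Proof. by move=> p0; rewrite !innerE !quatE p0; ring. Qed.

(* The triple product in R^4: the cofactors of the last row in [det4]. *)
Definition cross g t n : 'rV[R]_4 :=
  let det3 (x y z : 'rV[R]_4 -> R) :=
    x g * (y t * z n - z t * y n) - y g * (x t * z n - z t * x n)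
    + z g * (x t * y n - y t * x n) in
  quat (- det3 qi qj qk) (det3 qre qj qk) (- det3 qre qi qk) (det3 qre qi qj).

Lemma det4E g t n v : det4 g t n v = inner (cross g t n) v.
Proof.
pose f i j := [:: qre [:: g; t; n; v]`_i; qi [:: g; t; n; v]`_i;
  qj [:: g; t; n; v]`_i; qk [:: g; t; n; v]`_i]`_j.
transitivity (natdet 4 f).
  by congr (\det _); apply/matrixP => i j; rewrite !mxE coord_nth.
rewrite natdet_expand !big_nat_recr //= big_geq // add0r !natdet3.
by rewrite /f /bump /= innerE !quatE; ring.
Qed.

(** The right-hand side is the Gram determinant of g, t, n. *)
Lemma inner_cross g t n : inner (cross g t n) (cross g t n) =
  inner g g * (inner t t * inner n n - inner t n ^+ 2)
  - inner g t * (inner g t * inner n n - inner t n * inner g n)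
  + inner g n * (inner g t * inner t n - inner t t * inner g n).
Proof. by rewrite !innerE !quatE; ring. Qed.

Lemma cross_orth1 g t n : inner (cross g t n) g = 0.
Proof. by rewrite innerE !quatE; ring. Qed.

Lemma cross_orth2 g t n : inner (cross g t n) t = 0.
Proof. by rewrite innerE !quatE; ring. Qed.

Lemma cross_orth3 g t n : inner (cross g t n) n = 0.
Proof. by rewrite innerE !quatE; ring. Qed.

(** Self-duality of the 2-form (u, v) |-> <p u, v>; for orthonormal g, t, n only the term <p t, n>
    remains. Right multiplication gives an anti-self-dual form, hence the opposite sign in
    [cross_qmulr]. *)
Lemma cross_qmul p g t n : qre p = 0 ->
  inner (cross g t n) (qmul p g) = inner g g * inner (qmul p t) n
    - inner g t * inner (qmul p g) n + inner g n * inner (qmul p g) t.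
Proof. by move=> p0; rewrite !innerE !quatE p0; ring. Qed.

Lemma cross_qmulr p g t n : qre p = 0 ->
  inner (cross g t n) (qmulr p g) = - (inner g g * inner (qmulr p t) n
    - inner g t * inner (qmulr p g) n + inner g n * inner (qmulr p g) t).
Proof. by move=> p0; rewrite !innerE !quatE p0; ring. Qed.

End InnerProduct.

(** * Orthonormal frames of R^4 *)

Section Frames.
Context {R : realType}.
Implicit Types (u v w p q g t n : 'rV[R]_4) (a c : R).

Definition orthonormal3 g t n : Prop :=
  [/\ inner g g = 1, inner t t = 1, inner n n = 1 &
      [/\ inner g t = 0, inner g n = 0 & inner t n = 0]].

Lemma cross_unit g t n :
  orthonormal3 g t n -> inner (cross g t n) (cross g t n) = 1.
Proof.
by case=> gg tt nn [gt gn tn]; rewrite inner_cross gg tt nn gt gn tn; ring.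
Qed.

(** The matrix M with rows g, t, n and their cross product satisfies M M^T = 1, hence also M^T M =
    1, and v = (v M^T) M is the expansion. *)
Lemma frame_expand g t n v : orthonormal3 g t n ->
  v = inner v g *: g + inner v t *: t + inner v n *: n
      + inner v (cross g t n) *: cross g t n.
Proof.
move=> ogtn; have [gg tt nn [gt gn tn]] := ogtn.
set x := cross g t n; pose e i := [:: g; t; n; x]`_i.
pose M : 'M[R]_4 := \matrix_(i < 4) e i.
have MMT : M *m M^T = 1%:M.
  apply/matrixP => i j; transitivity (inner (e i) (e j)).
    by rewrite mxE; apply: eq_bigr => k _; rewrite !mxE.
  rewrite mxE; have xx : inner x x = 1 by exact: cross_unit.
  have [xg xt xn] : [/\ inner x g = 0, inner x t = 0 & inner x n = 0].
    by rewrite cross_orth1 cross_orth2 cross_orth3.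
  by case: i j => -[|[|[|[|//]]]] ? [[|[|[|[|//]]]] ?]; rewrite /e /= -?val_eqE /=;
    rewrite ?(gg, tt, nn, xx, gt, gn, tn, xg, xt, xn)// innerC.
rewrite -{1}[v]mulmx1 -(mulmx1C MMT) mulmxA mulmx_sum_row !big_ord_recl big_ord0.
have vM i : (v *m M^T) 0 i = inner v (e i).
  by rewrite mxE; apply: eq_bigr => k _; rewrite !mxE.
by rewrite !vM !rowK /= addr0 !addrA.
Qed.

Lemma parseval g t n u v : orthonormal3 g t n ->
  inner u v = inner u g * inner v g + inner u t * inner v t
    + inner u n * inner v n + inner u (cross g t n) * inner v (cross g t n).
Proof.
by move=> /frame_expand => /(_ u) {1}->; rewrite !innerDl !innerZl !(innerC _ v).
Qed.

(** Only the component of v along the cross product survives; its square is 1 and the determinant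
    makes it positive. *)
Lemma cross_unique g t n v : orthonormal3 g t n ->
  inner v v = 1 -> inner v g = 0 -> inner v t = 0 -> inner v n = 0 ->
  0 < det4 g t n v -> v = cross g t n.
Proof.
move=> ogtn vv vg vt vn; rewrite det4E innerC => vx.
rewrite [LHS](frame_expand v ogtn) vg vt vn !scale0r !add0r.
suff -> : inner v (cross g t n) = 1 by rewrite scale1r.
apply/eqP; rewrite -(@pexpr_eq1 _ _ 2) ?ltW// expr2.
by move: (parseval v v ogtn); rewrite vv vg vt vn !mul0r !add0r => <-.
Qed.

(** Equality case of Cauchy-Schwarz: |u - c v|^2 = 1 - c^2. *)
Lemma eq_of_inner_unit u v c : inner u u = 1 -> inner v v = 1 ->
  inner u v = c -> c ^+ 2 = 1 -> u = c *: v.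
Proof.
move=> uu vv uv c1; apply/eqP; rewrite -subr_eq0 -inner_eq0.
rewrite !(innerBl, innerBr, innerZl, innerZr) (innerC v) uu vv uv.
by rewrite mulr1 -expr2 c1; apply/eqP; ring.
Qed.

Lemma inner_sqr_le1 u v : inner u u = 1 -> inner v v = 1 ->
  inner u v ^+ 2 <= 1.
Proof.
move=> uu vv; have := inner_ge0 (u - inner u v *: v).
rewrite !(innerBl, innerBr, innerZl, innerZr) (innerC v) uu vv => h.
by rewrite -subr_ge0; apply: le_trans h _;
  rewrite le_eqVlt; apply/orP; left; apply/eqP; ring.
Qed.

Lemma normalize_unit u : u != 0 ->
  inner ((enorm u)^-1 *: u) ((enorm u)^-1 *: u) = 1.
Proof.
move=> u0; have e0 : enorm u != 0 by rewrite enorm_eq0.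
by rewrite innerZl innerZr -enorm_sqr; field.
Qed.

Lemma imaginary_parallel u v x y :
  qre u = 0 -> qre v = 0 -> qre x = 0 -> qre y = 0 ->
  x != 0 -> y != 0 -> inner x y = 0 ->
  inner u x = 0 -> inner u y = 0 -> inner v x = 0 -> inner v y = 0 ->
  inner u v ^+ 2 = inner u u * inner v v.
Proof.
move=> u0 v0 x0 y0 xN yN xy ux uy vx vy.
(* Imaginary means orthogonal to 1, so 1, x/|x|, y/|y| is an orthonormal triple, and u and v both
   lie on the fourth axis. *)
pose e : 'rV[R]_4 := quat 1 0 0 0.
have ere w : inner w e = qre w by rewrite innerE !quatE; ring.
have oexy : orthonormal3 e ((enorm x)^-1 *: x) ((enorm y)^-1 *: y).
  split; [by rewrite ere quatE|exact: normalize_unit|exact: normalize_unit|].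
  by rewrite !(innerC e) !(innerZl, innerZr) !ere x0 y0 xy !mulr0.
rewrite (parseval u v oexy) (parseval u u oexy) (parseval v v oexy).
rewrite !(innerZr, ere) u0 v0 ux uy vx vy.
by ring.
Qed.

End Frames.

(** * Differentiation along curves, linear Killing fields and a sign argument *)

Section Derivatives.
Context {R : realType}.
Implicit Types (U W : R -> 'rV[R]_4) (s : R) (F : {linear 'rV[R]_4 -> 'rV[R]_4}).

Lemma is_derive_rowP W s dW :
  is_derive s 1 W dW <-> forall i, is_derive s 1 (fun x => W x 0 i) (dW 0 i).
Proof.
split=> [[Ws <-] i|Ws].
  rewrite derive_mx // mxE; apply: DeriveDef => //.
  exact: (derivable_mxP W s 1).1.
have dW' : derivable W s 1.
  by apply/derivable_mxP => i j; rewrite ord1; case: (Ws j).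
apply: DeriveDef => //; rewrite derive_mx //.
by apply/rowP => j; rewrite mxE; case: (Ws j).
Qed.

Lemma is_derive_inner U W s dU dW : is_derive s 1 U dU -> is_derive s 1 W dW ->
  is_derive s 1 (fun x => inner (U x) (W x)) (inner dU (W s) + inner (U s) dW).
Proof.
move=> /is_derive_rowP Us /is_derive_rowP Ws.
have -> : (fun x => inner (U x) (W x)) =
    \sum_(i < 4) ((fun x => U x 0 i) * (fun x => W x 0 i)).
  by apply/funext => x; rewrite fct_sumE.
apply: is_derive_eq (is_derive_sum (fun i => is_deriveM (Us i) (Ws i))) _.
rewrite /inner -big_split; apply: eq_bigr => i _ /=.
by rewrite /GRing.scale /=; ring.
Qed.

Lemma is_derive_linear F W s dW :
  is_derive s 1 W dW -> is_derive s 1 (F \o W) (F dW).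
Proof.
move=> /is_derive_rowP Ws; apply/is_derive_rowP => j.
have FE v : F v 0 j = \sum_(i < 4) F (delta_mx 0 i) 0 j * v 0 i.
  rewrite {1}[v]row_sum_delta linear_sum summxE.
  by apply: eq_bigr => i _; rewrite linearZ mxE mulrC.
have -> : (fun x => (F \o W) x 0 j) =
    \sum_(i < 4) (F (delta_mx 0 i) 0 j \*: (fun x => W x 0 i)).
  by apply/funext => x; rewrite fct_sumE /= FE.
by apply: is_derive_eq (is_derive_sum (fun i => is_deriveZ _ (Ws i))) _; rewrite FE.
Qed.

Lemma is_derive_scale (f : R -> R) W s df dW :
  is_derive s 1 f df -> is_derive s 1 W dW ->
  is_derive s 1 (fun x => f x *: W x) (df *: W s + f s *: dW).
Proof.
move=> fs /is_derive_rowP Ws; apply/is_derive_rowP => j.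
have -> : (fun x => (f x *: W x) 0 j) = f * (fun x => W x 0 j).
  by apply/funext => x; rewrite mxE.
apply: is_derive_eq (is_deriveM fs (Ws j)) _.
by rewrite !mxE /GRing.scale /=; ring.
Qed.

Lemma derivable_is_derive1 W s :
  derivable W s 1 -> is_derive s 1 W (derive1 W s).
Proof. by move=> Ws; rewrite derive1E; exact: derivableP. Qed.

Lemma differentiable_linear F (p : 'rV[R]_4) : differentiable F p.
Proof.
have -> : F = (\sum_(i < 4) (fun v : 'rV[R]_4 => v 0 i *: F (delta_mx 0 i)))
    :> (_ -> _).
  apply/funext => v; rewrite fct_sumE {1}[v]row_sum_delta linear_sum.
  by apply: eq_bigr => i _; rewrite linearZ.
apply: differentiable_sum => i; apply: differentiableZl.
exact: differentiable_coord.
Qed.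

Lemma derive_linear F (v p : 'rV[R]_4) : 'D_v F p = F v.
Proof.
rewrite deriveE; last exact: differentiable_linear.
rewrite diff_lin // => x; apply: differentiable_continuous.
exact: differentiable_linear.
Qed.

Lemma smooth_linear F : smooth_field F.
Proof.
(* One derivative turns F into a constant, further ones into 0; the disjunction is the invariant of
   the induction on [vs]. *)
move=> vs p; have [-> //|[c ->]] : foldr (fun v G => 'D_v G) (F : _ -> _) vs = F \/
    exists c, foldr (fun v G => 'D_v G) (F : _ -> _) vs = cst c.
- elim: vs => [|v vs /= [->|[c ->]]]; first by left.
    by right; exists (F v); apply/funext => q; rewrite derive_linear.
  by right; exists 0; apply/funext => q; rewrite derive_cst.
- exact: differentiable_linear.
- exact: differentiable_cst.
Qed.

(** Skewness gives <F p, p> = 0, so F is tangent to the sphere. The derivative of F along u is F u,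
    and the projection terms vanish against tangent vectors. *)
Lemma killing_linear F :
  (forall u v, inner (F u) v = - inner u (F v)) -> killing_field F.
Proof.
move=> skewF; split=> [|p _|p u v _ pu pv]; first exact: smooth_linear.
  have := skewF p p; rewrite [inner (F p) p]innerC /tangent_at => h; lra.
rewrite /nabla !derive_linear /tproj !(innerBl, innerBr, innerZl, innerZr) skewF.
by rewrite pv [inner u p]innerC pu; ring.
Qed.

(** This turns a sign chosen at each parameter into one sign on a whole interval. *)
Lemma eqsign_on_interval (K : set R) (f : R -> R) (c : R) : is_interval K ->
  0 < c -> (forall s, K s -> f s = c \/ f s = - c) ->
  (forall s, K s -> {for s, continuous f}) ->
  (forall s, K s -> f s = c) \/ (forall s, K s -> f s = - c).
Proof.
move=> itvK c0 fc cf.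
have eqf x y : K x -> K y -> x <= y -> f x = f y.
  move=> Kx Ky xy.
  have Kz z : x <= z <= y -> K z by exact: itvK.
  (* If f x and f y had opposite signs, this intermediate value would be 0, which is neither c nor -
     c. *)
  have [z zxy fz] : exists2 z, x <= z <= y & f z = (f x + f y) / 2.
    have [||z] := @IVT _ f x y ((f x + f y) / 2) xy; last first.
    - by rewrite in_itv => ? ?; exists z.
    - by rewrite /Num.min /Num.max; case: ifP => h; apply/andP; split; lra.
    apply: continuous_in_subspaceT => z; rewrite inE /= in_itv => zxy.
    by apply: cf; exact: Kz.
  have [] := (fc _ (Kz _ zxy), fc _ Kx, fc _ Ky).
  by case=> [[|] ? [|] ? [|] ?]; lra.
have eqf' x y : K x -> K y -> f x = f y.
  by move=> Kx Ky; have [/eqf->//|/ltW/eqf->] := leP x y.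
have [[s Ks fs]|nK] := pselect (exists2 s, K s & f s = c).
  by left => x Kx; rewrite -fs; exact: eqf'.
right => x Kx; case: (fc x Kx) => // fx; by case: nK; exists x.
Qed.

End Derivatives.

(** Equality near s suffices, since the curve identities hold only on an open domain. *)
Lemma near_cst_is_derive (R : realType) (f : R -> R) (s c df : R) :
  (\forall x \near s, f x = c) -> is_derive s 1 f df -> df = 0.
Proof.
move=> fc fs; have [_ <-] := near_eq_is_derive fc fs.
exact: derive_cst.
Qed.

(** * Frenet apparatus of an arc length curve in the 3-sphere *)

Section ArclengthCurve.
Context {R : realType} (I : set R) (g : R -> 'rV[R]_4).
Hypothesis hg : arclength_curve I g.
Implicit Types (s c : R) (F : {linear 'rV[R]_4 -> 'rV[R]_4}).

Lemma near_dom s : I s -> \forall x \near s, I x.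
Proof. by case: hg => -[oI _ _] _ _ _ Is; apply: open_nbhs_nbhs. Qed.

Lemma is_derive_curve s : I s -> is_derive s 1 g (tangent g s).
Proof.
by case: hg => _ dg _ _ Is; apply: derivable_is_derive1; exact: (dg 0%N).
Qed.

Lemma is_derive_tangent s :
  I s -> is_derive s 1 (tangent g) (derive1 (tangent g) s).
Proof.
by case: hg => _ dg _ _ Is; apply: derivable_is_derive1; exact: (dg 1%N).
Qed.

Lemma is_derive_acceleration s : I s ->
  is_derive s 1 (derive1 (tangent g)) (derive1 (derive1 (tangent g)) s).
Proof.
by case: hg => _ dg _ _ Is; apply: derivable_is_derive1; exact: (dg 2%N).
Qed.

Lemma inner_curve s : I s -> inner (g s) (g s) = 1.
Proof. by case: hg => _ _ sg _ Is; apply/enorm1P; exact: sg. Qed.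

Lemma inner_tangent s : I s -> inner (tangent g s) (tangent g s) = 1.
Proof. by case: hg => _ _ _ tg Is; apply/enorm1P; exact: tg. Qed.

Lemma inner_curve_tangent s : I s -> inner (g s) (tangent g s) = 0.
Proof.
move=> Is; have gs := is_derive_curve Is.
have : inner (tangent g s) (g s) + inner (g s) (tangent g s) = 0.
  apply: near_cst_is_derive (is_derive_inner gs gs).
  by near do apply: inner_curve; exact: near_dom.
by rewrite [inner (tangent g s) _]innerC; lra.
Unshelve. all: by end_near. Qed.

Lemma inner_curve_acceleration s :
  I s -> inner (g s) (derive1 (tangent g) s) = -1.
Proof.
move=> Is; have gs := is_derive_curve Is; have ts := is_derive_tangent Is.
have : inner (tangent g s) (tangent g s)
    + inner (g s) (derive1 (tangent g) s) = 0.
  apply: near_cst_is_derive (is_derive_inner gs ts).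
  by near do apply: inner_curve_tangent; exact: near_dom.
by rewrite inner_tangent //; lra.
Unshelve. all: by end_near. Qed.

Lemma inner_tangent_acceleration s :
  I s -> inner (tangent g s) (derive1 (tangent g) s) = 0.
Proof.
move=> Is; have ts := is_derive_tangent Is.
have : inner (derive1 (tangent g) s) (tangent g s)
    + inner (tangent g s) (derive1 (tangent g) s) = 0.
  apply: near_cst_is_derive (is_derive_inner ts ts).
  by near do apply: inner_tangent; exact: near_dom.
by rewrite [inner (derive1 _ s) _]innerC; lra.
Unshelve. all: by end_near. Qed.

(** The component of g'' along g is - 1, so removing it adds g. *)
Lemma covd_tangentE s :
  I s -> covd g (tangent g) s = derive1 (tangent g) s + g s.
Proof.
move=> Is.
by rewrite /covd /tproj innerC inner_curve_acceleration // scaleN1r opprK.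
Qed.

Lemma inner_curve_covd s : I s -> inner (g s) (covd g (tangent g) s) = 0.
Proof.
move=> Is; rewrite covd_tangentE // innerDr inner_curve_acceleration //.
by rewrite inner_curve // addNr.
Qed.

Lemma inner_tangent_covd s :
  I s -> inner (tangent g s) (covd g (tangent g) s) = 0.
Proof.
move=> Is; rewrite covd_tangentE // innerDr inner_tangent_acceleration //.
by rewrite add0r innerC inner_curve_tangent.
Qed.

Lemma curvature_eq0 s : (curvature g s == 0) = (covd g (tangent g) s == 0).
Proof. exact: enorm_eq0. Qed.

(** Differentiating <F g, g'> = c gives <F g', g'> + <F g, g''> = 0, whose first term vanishes by
    skewness; replacing g'' by g'' + g adds <F g, g> = 0. *)
Lemma skew_covd F c : (forall u v, inner (F u) v = - inner u (F v)) ->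
  (forall s, I s -> inner (F (g s)) (tangent g s) = c) ->
  forall s, I s -> inner (F (g s)) (covd g (tangent g) s) = 0.
Proof.
move=> skewF Fc s Is; have gs := is_derive_curve Is.
have skew0 u : inner (F u) u = 0.
  by have := skewF u u; rewrite [inner u (F u)]innerC; lra.
rewrite covd_tangentE // innerDr skew0 addr0.
have /near_cst_is_derive :=
  is_derive_inner (is_derive_linear F gs) (is_derive_tangent Is).
move=> /(_ c); rewrite skew0 add0r; apply.
by near do apply: Fc; exact: near_dom.
Unshelve. all: by end_near. Qed.

Lemma is_derive_covd s : I s ->
  is_derive s 1 (covd g (tangent g))
    (derive1 (derive1 (tangent g)) s + tangent g s).
Proof.
move=> Is; apply: near_eq_is_derive
  (is_deriveD (is_derive_acceleration Is) (is_derive_curve Is)).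
by near do rewrite covd_tangentE //; exact: near_dom.
Unshelve. all: by end_near. Qed.

Lemma derivable_curvature s : I s -> curvature g s != 0 ->
  derivable (curvature g) s 1.
Proof.
move=> Is k0; have cs := is_derive_covd Is.
have pos : 0 < inner (covd g (tangent g) s) (covd g (tangent g) s).
  by apply: inner_gt0; rewrite -curvature_eq0.
by have [] := is_derive1_comp (is_derive1_sqrt pos) (is_derive_inner cs cs).
Qed.

(** Nonvanishing curvature is an open condition, so the identities of the Frenet frame can be
    differentiated. *)
Lemma near_curvature s : I s -> curvature g s != 0 ->
  \forall x \near s, I x /\ curvature g x != 0.
Proof.
move=> Is k0; have kc : {for s, continuous (curvature g)}.
  apply: differentiable_continuous; apply/derivable1_diffP.
  exact: derivable_curvature.
have kN0 : nbhs (curvature g s) [set y | y != 0].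
  by apply: open_nbhs_nbhs; split => //; exact: open_neq.
by near=> x; split; near: x; [exact: near_dom|exact: kc kN0].
Unshelve. all: by end_near. Qed.

Lemma is_derive_normal s : I s -> curvature g s != 0 ->
  exists dn, is_derive s 1 (normal g) dn.
Proof.
move=> Is k0; have ks := derivableP (derivable_curvature Is k0).
by eexists; exact: is_derive_scale (is_deriveV k0 ks) (is_derive_covd Is).
Qed.

Lemma covd_normal s : curvature g s != 0 ->
  covd g (tangent g) s = curvature g s *: normal g s.
Proof. by move=> k0; rewrite /normal scalerA divff // scale1r. Qed.

Lemma orthonormal_frame s : I s -> curvature g s != 0 ->
  orthonormal3 (g s) (tangent g s) (normal g s).
Proof.
move=> Is k0; split; [exact: inner_curve|exact: inner_tangent| |].
  by apply: normalize_unit; rewrite -curvature_eq0.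
rewrite inner_curve_tangent // /normal !innerZr inner_curve_covd //.
by rewrite inner_tangent_covd // mulr0.
Qed.

(** These come from differentiating <g, n> = 0, <t, n> = 0 and <n, n> = 1. *)
Lemma inner_normal_derivative s dn : I s -> curvature g s != 0 ->
  is_derive s 1 (normal g) dn ->
  [/\ inner dn (g s) = 0, inner dn (tangent g s) = - curvature g s
    & inner dn (normal g s) = 0].
Proof.
move=> Is k0 ns.
have [_ _ nn [_ gn tn]] := orthonormal_frame Is k0.
have near_frame : \forall x \near s, orthonormal3 (g x) (tangent g x) (normal g x).
  by apply: filterS (near_curvature Is k0) => x []; exact: orthonormal_frame.
have gn' : inner (tangent g s) (normal g s) + inner (g s) dn = 0.
  apply: (near_cst_is_derive (c := 0)) (is_derive_inner (is_derive_curve Is) ns).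
  by apply: filterS near_frame => x [_ _ _ [? ? ?]].
have tn' : inner (derive1 (tangent g) s) (normal g s) + inner (tangent g s) dn = 0.
  apply: (near_cst_is_derive (c := 0)) (is_derive_inner (is_derive_tangent Is) ns).
  by apply: filterS near_frame => x [_ _ _ [? ? ?]].
have nn' : inner dn (normal g s) + inner (normal g s) dn = 0.
  apply: (near_cst_is_derive (c := 1)) (is_derive_inner ns ns).
  by apply: filterS near_frame => x [_ _ ? _].
(* Pair g'' + g = kappa n with n and use <g, n> = 0. *)
have an : inner (derive1 (tangent g) s) (normal g s) = curvature g s.
  have := covd_tangentE Is; rewrite covd_normal // => /(congr1 (inner^~ (normal g s))).
  by rewrite innerZl innerDl nn gn; lra.
rewrite !(innerC dn) in nn' *; move: gn' tn' nn'; rewrite an tn => *.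
by split; lra.
Qed.

(** The cross product meets the defining conditions and [cross_unique] makes it the only such
    vector, so [xget] returns it and not the default 0. *)
Lemma binormalE s : I s -> curvature g s != 0 ->
  binormal g s = cross (g s) (tangent g s) (normal g s).
Proof.
move=> Is k0; have ogtn := orthonormal_frame Is k0.
apply: xget_unique => [|v [vg /enorm1P vv vt vn vd]]; last first.
  by apply: cross_unique; rewrite // innerC.
split; [|exact/enorm1P/cross_unit|exact: cross_orth2|exact: cross_orth3|].
  by rewrite /tangent_at innerC cross_orth1.
by rewrite det4E cross_unit.
Qed.

(** In the frame, the tangential part of n' has only a t-component, equal to - kappa, and a binormal
    component; the binormal is a unit vector, so the coefficient selected by [xget] is unique. *)
Lemma torsionE s dn : I s -> curvature g s != 0 ->
  is_derive s 1 (normal g) dn ->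
  torsion g s = inner dn (cross (g s) (tangent g s) (normal g s)).
Proof.
move=> Is k0 ns; have ogtn := orthonormal_frame Is k0.
have [ng nt nn] := inner_normal_derivative Is k0 ns.
have cE : covd g (normal g) s = - curvature g s *: tangent g s
    + inner dn (binormal g s) *: binormal g s.
  rewrite /covd /tproj derive1E; have [_ ->] := ns.
  rewrite ng scale0r subr0 binormalE // {1}(frame_expand dn ogtn) ng nt nn.
  by rewrite !scale0r add0r addr0.
rewrite -binormalE //; apply: xget_unique => // tau /=.
rewrite cE => /addrI /(congr1 (inner (binormal g s))).
by rewrite !innerZr binormalE // cross_unit // !mulr1.
Qed.

End ArclengthCurve.

(** * Curves making a constant angle with a linear Killing field *)

Section Helix.
Context {R : realType} (I : set R) (g : R -> 'rV[R]_4).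
Hypothesis hg : arclength_curve I g.
Variables (F : {linear 'rV[R]_4 -> 'rV[R]_4}) (e c : R).
Hypothesis skewF : forall u v, inner (F u) v = - inner u (F v).
Hypothesis isoF : forall u v, inner (F u) (F v) = inner u v.
(* The sign [e] tells whether F is self-dual or anti-self-dual. *)
Hypothesis orientF : forall p t n, orthonormal3 p t n ->
  inner (cross p t n) (F p) = e * inner (F t) n.
Hypothesis e1 : e ^+ 2 = 1.
Hypothesis Fc : forall s, I s -> inner (F (g s)) (tangent g s) = c.
Hypothesis c1 : c ^+ 2 != 1.

Lemma linear_unit s : I s -> enorm (F (g s)) = 1.
Proof. by move=> Is; apply/enorm1P; rewrite isoF (inner_curve hg). Qed.

Lemma sqr_slope_lt1 : c ^+ 2 < 1.
Proof.
case: hg => -[_ _ [s Is]] _ _ _; rewrite lt_def eq_sym c1 /= -(Fc Is).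
apply: inner_sqr_le1; first exact/enorm1P/linear_unit.
exact: (inner_tangent hg).
Qed.

(** The field F has unit length along g, so the angle is acos c, which is nonzero because c < 1. *)
Lemma helix_of_linear : general_helix I g.
Proof.
exists F; split; first exact: killing_linear.
exists 1, (acos c); split => // [|s Is].
  by have c2 := sqr_slope_lt1; rewrite gt_eqF // acos_gt0 //; apply/andP; split; nra.
split; first exact: linear_unit.
rewrite /angle Fc // linear_unit // (enorm1P _).2 ?mulr1 ?divr1 //.
exact: (inner_tangent hg).
Qed.

Lemma helix_torsion : torsion_relation I g c (- e).
Proof.
(* This is the binormal component of F g, written through F t and n so that its continuity follows
   without differentiating the binormal. *)
pose h s := e * inner (F (tangent g s)) (normal g s).
have hE s : I s -> curvature g s != 0 ->
    h s = inner (F (g s)) (cross (g s) (tangent g s) (normal g s)).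
  move=> Is k0.
  by rewrite innerC orientF //; exact: (orthonormal_frame hg).
have Fn s : I s -> curvature g s != 0 -> inner (F (g s)) (normal g s) = 0.
  by move=> Is k0; rewrite /normal innerZr (skew_covd hg skewF Fc) // mulr0.
have Fg0 s : inner (F (g s)) (g s) = 0.
  by have := skewF (g s) (g s); rewrite [inner (g s) _]innerC; lra.
(* The unit vector F g has components 0, c, 0, h in the frame g, t, n, b. *)
have h2 s : I s -> curvature g s != 0 -> h s ^+ 2 = 1 - c ^+ 2.
  move=> Is k0; have ogtn := orthonormal_frame hg Is k0.
  have := parseval (F (g s)) (F (g s)) ogtn.
  by rewrite isoF (inner_curve hg) // Fg0 Fc // Fn // -hE //; lra.
have torsion_h s : I s -> curvature g s != 0 ->
    torsion g s = c / h s * curvature g s - e.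
  move=> Is k0; have ogtn := orthonormal_frame hg Is k0.
  have [dn ns] := is_derive_normal hg Is k0.
  have [ng nt nn] := inner_normal_derivative hg Is k0 ns.
  (* This is the derivative of <F g, n> = 0. *)
  have Fgn : inner (F (tangent g s)) (normal g s) + inner (F (g s)) dn = 0.
    apply: (@near_cst_is_derive _ (fun x => inner (F (g x)) (normal g x)) s 0).
      by apply: filterS (near_curvature hg Is k0) => x []; exact: Fn.
    exact: is_derive_inner (is_derive_linear F (is_derive_curve hg Is)) ns.
  have Ft : inner (F (tangent g s)) (normal g s) = e * h s.
    by rewrite /h mulrA -expr2 e1 mul1r.
  have h0 : h s != 0.
    by rewrite -sqrf_eq0 h2 // subr_eq0 eq_sym.
  (* Expanding <F g, n'> in the frame gives e h - c kappa + h tau = 0, to be divided by h. *)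
  move: Fgn; rewrite (parseval (F (g s)) dn ogtn) Fg0 Fc // Fn // ng nt nn -hE //.
  rewrite -(torsionE hg Is k0 ns) Ft => rel.
  apply: (mulfI h0); transitivity (c * curvature g s - e * h s); first lra.
  by field.
have c2 : 0 < 1 - c ^+ 2 by rewrite subr_gt0 sqr_slope_lt1.
(* Since h^2 = 1 - c^2, h is eta or - eta at each parameter, with a constant sign on K by
   continuity. *)
exists (Num.sqrt (1 - c ^+ 2)); split=> [|K itvK KI Kk].
  by rewrite gt_eqF // sqrtr_gt0.
have [|s Ks|s Ks|hK|hK] := @eqsign_on_interval _ K h (Num.sqrt (1 - c ^+ 2)) itvK.
- by rewrite sqrtr_gt0.
- have := h2 s (KI s Ks) (Kk s Ks); rewrite -{1}(sqr_sqrtr (ltW c2)) => /eqP.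
  by rewrite eqf_sqr => /orP[] /eqP; [left|right].
- have [dn ns] := is_derive_normal hg (KI s Ks) (Kk s Ks).
  apply: differentiable_continuous; apply/derivable1_diffP.
  have [hs _] :=
    is_derive_inner (is_derive_linear F (is_derive_tangent hg (KI s Ks))) ns.
  rewrite (_ : h = e \*: (fun x => inner (F (tangent g x)) (normal g x))) //.
  exact: derivableZ.
- by left => s Ks; rewrite torsion_h ?hK //; [exact: KI|exact: Kk].
- by right => s Ks; rewrite torsion_h ?hK //; [exact: KI|exact: Kk].
Qed.

End Helix.

(** * The indicatrices a and b, and the consequences of <a, b> = C *)

Section Rigidity.
Context {R : realType} (I J : set R) (alpha beta : R -> 'rV[R]_4) (C : R).
Hypothesis halpha : arclength_curve I alpha.
Hypothesis hbeta : arclength_curve J beta.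

Let a s := qmul (qconj (alpha s)) (tangent alpha s).
Let b t := qmul (beta t) (qconj (tangent beta t)).
(* [da] and [db] are the derivatives of [a] and [b], written algebraically. *)
Let da s := qmul (qconj (alpha s)) (covd alpha (tangent alpha) s).
Let db t := qmul (beta t) (qconj (covd beta (tangent beta) t)).

(** In effect <a, q> = c is differentiated: <a, q> = <alpha q, alpha'>, and right multiplication by
    an imaginary q is skew, so [skew_covd] applies. *)
Lemma left_indicatrix_orth q c : qre q = 0 ->
  (forall s, I s -> inner (a s) q = c) -> forall s, I s -> inner (da s) q = 0.
Proof.
move=> q0 aq s Is; rewrite inner_conj_mul.
apply: (skew_covd halpha (F := qmulr q) (c := c)) => // [u v|x Ix].
  exact: qmulr_skew.
by rewrite -inner_conj_mul; exact: aq.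
Qed.

Lemma qre_conj q : qre (qconj q : 'rV[R]_4) = qre q.
Proof. by rewrite quatE. Qed.

Lemma right_indicatrix_orth q c : qre q = 0 ->
  (forall t, J t -> inner q (b t) = c) -> forall t, J t -> inner q (db t) = 0.
Proof.
move=> q0 bq t Jt; rewrite inner_mul_conj.
apply: (skew_covd hbeta (F := qmul (qconj q)) (c := c)) => // [u v|x Jx].
  by apply: qmul_skew; rewrite qre_conj.
by rewrite -inner_mul_conj; exact: bq.
Qed.

Lemma indicatrices_unit s t : I s -> J t ->
  [/\ inner (a s) (a s) = 1, inner (b t) (b t) = 1, qre (a s) = 0 & qre (b t) = 0].
Proof.
move=> Is Jt; rewrite inner_qmul inner_qmul !inner_qconj qre_conj_mul qre_mul_conj.
rewrite (inner_curve halpha) // (inner_curve hbeta) // (inner_tangent halpha) //.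
rewrite (inner_tangent hbeta) // (inner_curve_tangent halpha) //.
by rewrite (inner_curve_tangent hbeta) // mulr1.
Qed.

Lemma indicatrices_derivative s t : I s -> J t ->
  [/\ qre (da s) = 0, qre (db t) = 0, inner (a s) (da s) = 0
    & inner (b t) (db t) = 0].
Proof.
move=> Is Jt; rewrite !inner_qmul !inner_qconj qre_conj_mul qre_mul_conj.
rewrite (inner_curve_covd halpha) // (inner_curve_covd hbeta) //.
by rewrite (inner_tangent_covd halpha) // (inner_tangent_covd hbeta) // !mulr0.
Qed.

(** Multiplication by the unit quaternion conj(alpha) preserves length, so |a'| is the curvature. *)
Lemma left_curvature_eq0 s : I s -> (curvature alpha s == 0) = (da s == 0).
Proof.
move=> Is; rewrite curvature_eq0 -!inner_eq0 inner_qmul inner_qconj.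
by rewrite (inner_curve halpha) // mul1r.
Qed.

Lemma right_curvature_eq0 t : J t -> (curvature beta t == 0) = (db t == 0).
Proof.
move=> Jt; rewrite curvature_eq0 -!inner_eq0 inner_qmul inner_qconj.
by rewrite (inner_curve hbeta) // mul1r.
Qed.

Hypothesis hC : forall s t, I s -> J t -> inner (a s) (b t) = C.

Lemma constant_one s t : I s -> J t -> curvature alpha s != 0 ->
  curvature beta t != 0 -> C ^+ 2 = 1.
Proof.
move=> Is Jt; rewrite left_curvature_eq0 // right_curvature_eq0 // => ds0 dt0.
have [aa bb a0 b0] := indicatrices_unit Is Jt.
have [da0 db0 ada bdb] := indicatrices_derivative Is Jt.
have dab x : J x -> inner (da s) (b x) = 0.
  move=> Jx; have [_ _ _ bx0] := indicatrices_unit Is Jx.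
  by apply: (left_indicatrix_orth (c := C)) => // y Iy; exact: hC.
have adb : inner (a s) (db t) = 0.
  by apply: (right_indicatrix_orth (c := C)) => // y Jy; exact: hC.
(* The relation <a'(s), b> = 0 holds along all of J, so it can be differentiated once more, with the
   imaginary vector a'(s) fixed. *)
have dadb : inner (da s) (db t) = 0 by exact: right_indicatrix_orth dab _ _.
rewrite -(hC Is Jt) (imaginary_parallel a0 b0 da0 db0) ?aa ?bb ?mulr1 //.
by rewrite innerC dab.
Qed.

Lemma left_curvature0 : C ^+ 2 = 1 -> forall s, I s -> curvature alpha s = 0.
Proof.
move=> C1 s Is; apply/eqP; rewrite left_curvature_eq0 // -inner_eq0; apply/eqP.
have [t Jt] : J !=set0 by case: hbeta => -[].
have [da0 _ _ _] := indicatrices_derivative Is Jt.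
(* Test against q = a'(s) itself: a is the constant C b(t), so its pairing with q is constant, and
   a'(s) is orthogonal to itself. *)
apply: (left_indicatrix_orth (c := C * inner (b t) (da s))) => // x Ix.
have [aa bb _ _] := indicatrices_unit Ix Jt.
by rewrite (eq_of_inner_unit aa bb (hC Ix Jt) C1) innerZl.
Qed.

Lemma right_curvature0 : C ^+ 2 = 1 -> forall t, J t -> curvature beta t = 0.
Proof.
move=> C1 t Jt; apply/eqP; rewrite right_curvature_eq0 // -inner_eq0; apply/eqP.
have [s Is] : I !=set0 by case: halpha => -[].
have [_ db0 _ _] := indicatrices_derivative Is Jt.
apply: (right_indicatrix_orth (c := C * inner (db t) (a s))) => // x Jx.
have [aa bb _ _] := indicatrices_unit Is Jx.
have ba : inner (b x) (a s) = C by rewrite innerC hC.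
by rewrite (eq_of_inner_unit bb aa ba C1) innerZr.
Qed.

Lemma right_helix : C ^+ 2 != 1 ->
  general_helix J beta /\ torsion_relation J beta C (- 1).
Proof.
move=> C1; have [s Is] : I !=set0 by case: halpha => -[].
have [t Jt] : J !=set0 by case: hbeta => -[].
have [aa _ a0 _] := indicatrices_unit Is Jt.
(* One value of a is frozen; left multiplication by its conjugate is the required Killing field. *)
pose p := qconj (a s); have p0 : qre p = 0 by rewrite qre_conj.
have pp : inner p p = 1 by rewrite inner_qconj.
have skew u v : inner (qmul p u) v = - inner u (qmul p v) by exact: qmul_skew.
have iso u v : inner (qmul p u) (qmul p v) = inner u v.
  by rewrite inner_qmul pp mul1r.
have slope x : J x -> inner (qmul p (beta x)) (tangent beta x) = C.
  by move=> Jx; rewrite -inner_mul_conj hC.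
split; first exact: (helix_of_linear hbeta skew iso slope C1).
apply: (helix_torsion hbeta skew iso _ _ slope C1); last by rewrite expr1n.
(* Self-duality gives the sign e = 1, hence the offset - 1. *)
move=> g u n [gg _ _ [gu gn _]].
by rewrite cross_qmul // gg gu gn; ring.
Qed.

Lemma left_helix : C ^+ 2 != 1 ->
  general_helix I alpha /\ torsion_relation I alpha C 1.
Proof.
move=> C1; have [s Is] : I !=set0 by case: halpha => -[].
have [t Jt] : J !=set0 by case: hbeta => -[].
have [_ bb _ b0] := indicatrices_unit Is Jt.
have skew u v : inner (qmulr (b t) u) v = - inner u (qmulr (b t) v).
  exact: qmulr_skew.
have iso u v : inner (qmulr (b t) u) (qmulr (b t) v) = inner u v.
  by rewrite inner_qmulr bb mul1r.
have slope x : I x -> inner (qmulr (b t) (alpha x)) (tangent alpha x) = C.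
  by move=> Ix; rewrite -inner_conj_mul hC.
split; first exact: (helix_of_linear halpha skew iso slope C1).
(* The offset 1 is - e for e = - 1, the sign of an anti-self-dual field. *)
rewrite -[1]opprK.
apply: (helix_torsion halpha skew iso _ _ slope C1); last by rewrite sqrrN expr1n.
move=> g u n [gg _ _ [gu gn _]].
by rewrite cross_qmulr // gg gu gn; ring.
Qed.

End Rigidity.

(** Replacing (alpha, beta) by (conj(beta), conj(alpha)) exchanges a and b and preserves the
    hypothesis, so either curve may be the geodesic; hence the two alternatives. *)
Theorem corollary3p1 (R : realType) (I J : set R)
    (alpha beta : R -> 'rV[R]_4) (C : R)
    (halpha : arclength_curve I alpha) (hbeta : arclength_curve J beta)
    (hC : forall s t, I s -> J t ->
       inner (qmul (qconj (alpha s)) (tangent alpha s))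
             (qmul (beta t) (qconj (tangent beta t))) = C) :
  ((forall s, I s -> curvature alpha s = 0) /\
   ((forall t, J t -> curvature beta t = 0) \/
    (general_helix J beta /\ torsion_relation J beta C (- 1))))
  \/
  ((forall t, J t -> curvature beta t = 0) /\
   (general_helix I alpha /\ torsion_relation I alpha C 1)).
Proof.
have [C1|C1] := eqVneq (C ^+ 2) 1.
  left; split; first exact: left_curvature0 halpha hbeta hC C1.
  by left; exact: right_curvature0 halpha hbeta hC C1.
have [ka|] := pselect (forall s, I s -> curvature alpha s = 0).
  by left; split => //; right; exact: right_helix halpha hbeta hC C1.
(* One parameter with nonzero curvature of alpha is enough: a nonzero curvature of beta anywhere
   would force C^2 = 1. *)
move=> /existsNP[s /not_implyP[Is /eqP ks]]; right; split.
  move=> t Jt; apply/eqP; apply: contra_neqT C1 => kt.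
  exact: (constant_one halpha hbeta hC Is Jt ks kt).
exact: left_helix halpha hbeta hC C1.
Qed.
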